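(* Let $A$ be a nonempty finite subset of an abelian group $(G,+)$. Let $h\ge 2$ be an integer and let $x\ge h$ be the unique real number such that $|hA|=\binom{x}{h}$. Then $$|(h-1)A|\ge \binom{x-1}{h-1}\quad\text{and}\quad |(h+1)A|\le\binom{x+1}{h+1}.$$
   Context: For an integer $h\ge 1$, $hA=\{x_1+\dots+x_h \mid x_1,\dots,x_h\in A\}$ denotes the $h$-fold iterated sumset of $A$. For $m\in\mathbb{N}$ and $x\in\mathbb{R}$, $\binom{x}{m}=\frac{x(x-1)\cdots(x-m+1)}{m!}$, with $\binom{x}{0}=1$. For every integer $h\ge1$ and positive integer $d$ there is a unique real number $x\ge h$ with $\binom{x}{h}=d$. *)

(* Defs.v *)
From mathcomp Require Import all_boot all_order all_algebra finmap reals.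
Set Implicit Arguments.
Unset Strict Implicit.
Unset Printing Implicit Defensive.
Import GRing.Theory Num.Theory.
Local Open Scope ring_scope.

Definition hsumset (G : zmodType) (h : nat) (A : {fset G}) : {fset G} :=
  [fset \sum_(i < h) val (tnth x i) | x in {: h.-tuple A}]%fset.

Lemma hsumsetP (G : zmodType) (h : nat) (A : {fset G}) (y : G) :
  y \in hsumset h A <->
  exists x : 'I_h -> G, (forall i, x i \in A) /\ y = \sum_(i < h) x i.
Proof.
split.
  by case/imfsetP=> t _ ->; exists (fun i => val (tnth t i)); split=> // i; apply: valP.
case=> x [xA ->]; apply/imfsetP; exists [tuple [` xA i]%fset | i < h] => //=.
by apply: eq_bigr => i _; rewrite tnth_mktuple.
Qed.

Definition rbinom (R : realType) (x : R) (m : nat) : R :=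
  (\prod_(i < m) (x - i%:R)) / (m`!)%:R.

(* Main.v *)
(** Choosing for each element of kA its representation of least weight, as a
    monomial of degree k in the elements of A, identifies |kA| with the number
    M_k of degree-k monomials in an order ideal M.  The upper bound is thus
    Macaulay's theorem in Lovász' form.  It follows, after summing over the
    variables v, from
      h * (total multiplicity of v in M_(h+1)) <= (x + 1) * (total multiplicity of v in M_h)
    whenever |M_h| = binom(x, h).  This is proved by induction on h, passing to
    the colon ideal (M : v).  The lower bound is the contrapositive of the upper
    bound in degree h - 1. *)

Require Import Defs.
From mathcomp Require Import all_boot all_order all_algebra finmap reals.
From mathcomp Require Import ring lra.
Set Implicit Arguments.
Unset Strict Implicit.
Unset Printing Implicit Defensive.
Import Order.TTheory GRing.Theory Num.Theory.
Local Open Scope fset_scope.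
Local Open Scope ring_scope.

(** * Real binomial coefficients and the numerical inequality behind the induction *)

Section RealBinomial.
Variable R : realType.
Implicit Types (x y : R) (k : nat).

Lemma rbinom0 x : rbinom x 0 = 1.
Proof. by rewrite /rbinom big_ord0 divr1. Qed.

Lemma rbinomSr x k : rbinom x k.+1 = rbinom x k * ((x - k%:R) / k.+1%:R).
Proof.
rewrite /rbinom big_ord_recr /= factS natrM invfM.
by rewrite [_ * (k`!)%:R^-1]mulrC mulrACA.
Qed.

Lemma rbinomSl x k : rbinom x k.+1 = x / k.+1%:R * rbinom (x - 1) k.
Proof.
rewrite /rbinom big_ord_recl /= subr0 factS natrM invfM.
under eq_bigr => i _ do rewrite /bump /= add1n -natr1 opprD addrA addrAC.
by rewrite mulrACA.
Qed.

Lemma rbinom_gt0 x k : k%:R <= x -> 0 < rbinom x k.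
Proof.
elim: k => [|k IH] hx; first by rewrite rbinom0.
have hk : k%:R + 1 <= x by rewrite natr1.
have px : 0 < rbinom x k by apply: IH; lra.
by rewrite rbinomSr mulr_gt0 // divr_gt0 ?ltr0n //; lra.
Qed.

Lemma rbinom_mono x y k : k%:R <= x -> x <= y -> rbinom x k <= rbinom y k.
Proof.
elim: k => [|k IH] hx hxy; first by rewrite !rbinom0.
have hk : k%:R + 1 <= x by rewrite natr1.
rewrite !rbinomSr; apply: ler_pM.
- by apply/ltW/rbinom_gt0; lra.
- by rewrite divr_ge0 //; lra.
- by apply: IH; lra.
- by rewrite ler_pM2r ?invr_gt0 ?ltr0n //; lra.
Qed.

Lemma rbinom_smono x y k :
  k.+1%:R <= x -> x < y -> rbinom x k.+1 < rbinom y k.+1.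
Proof.
move=> hx hxy; have hk : k%:R + 1 <= x by rewrite natr1.
have px : 0 < rbinom x k by apply: rbinom_gt0; lra.
have hle : rbinom x k <= rbinom y k by apply: rbinom_mono; lra.
rewrite !rbinomSr; apply: (@lt_le_trans _ _ (rbinom x k * ((y - k%:R) / k.+1%:R))).
  by rewrite ltr_pM2l // ltr_pM2r ?invr_gt0 ?ltr0n //; lra.
by rewrite ler_wpM2r // divr_ge0 //; lra.
Qed.

Lemma rbinom_diag k : rbinom (k%:R : R) k = 1.
Proof.
elim: k => [|k IH]; first by rewrite rbinom0.
by rewrite rbinomSl -natr1 addrK IH mulr1 divff // natr1 pnatr_eq0.
Qed.

(** Each induction step multiplies by a factor at least 1. The linear growth supplies the upper end
    point for the intermediate value theorem in [rbinom_surj]. *)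
Lemma rbinom_ge k (t : R) : 0 <= t -> 1 + t <= rbinom (k.+1%:R + t) k.+1.
Proof.
move=> t0; elim: k => [|k IH].
  by rewrite rbinomSl rbinom0 mulr1 divr1.
rewrite rbinomSl (_ : _ + t - 1 = k.+1%:R + t); last first.
  by rewrite -[k.+2%:R]natr1; ring.
apply: (le_trans IH); rewrite ler_peMl //.
  by apply/ltW/rbinom_gt0; rewrite lerDl.
by rewrite ler_pdivlMr ?ltr0n // mul1r lerDl.
Qed.

Definition rbinom_poly k : {poly R} :=
  (k`!%:R)^-1 *: \prod_(i < k) ('X - (i%:R)%:P).

Lemma horner_rbinom_poly k x : (rbinom_poly k).[x] = rbinom x k.
Proof.
rewrite /rbinom_poly hornerZ horner_prod /rbinom mulrC; congr (_ / _).
by apply: eq_bigr => i _; rewrite !hornerE.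
Qed.

Lemma rbinom_surj k (d : nat) : (0 < d)%N ->
  exists2 y : R, k.+1%:R <= y & rbinom y k.+1 = d%:R.
Proof.
move=> d0.
have le0 : k.+1%:R <= (k.+1%:R + d%:R : R) by rewrite lerDl.
have bnd : rbinom (k.+1%:R : R) k.+1 <= d%:R <= rbinom (k.+1%:R + d%:R : R) k.+1.
  rewrite rbinom_diag ler1n d0 /=; apply: le_trans (rbinom_ge k _) => //.
  by rewrite lerDr.
pose p := rbinom_poly k.+1 - d%:R%:P.
have pE z : p.[z] = rbinom z k.+1 - d%:R.
  by rewrite hornerD hornerN hornerC horner_rbinom_poly.
have [|y /andP[hy _]] := @poly_ivt R p _ _ le0.
  by rewrite !pE subr_le0 subr_ge0.
by rewrite rootE pE subr_eq0 => /eqP; exists y.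
Qed.

(* Inductive step of [mult_growth]: [a], [A] (resp. [b], [B]) are the cardinal
   and the multiplicity of [v] for [colon M v] in degree [k.+2] (resp. [k.+1]). *)
Lemma growth_step_ineq x y a b A B k :
    k.+2%:R <= x -> k.+1%:R <= y -> rbinom y k.+1 = b -> 0 <= B ->
    a <= rbinom x k.+2 -> A <= b + B ->
    k.+1%:R * A <= (y + 1) * B -> k.+2%:R * a <= (y + 1) * b ->
  k.+2%:R * (a + A) <= (x + 1) * (b + B).
Proof.
move=> hx hy bE B0 a_le A_le A_le' a_le'.
have b0 : 0 < b by rewrite -bE rbinom_gt0.
have n1 : 1 <= k.+1%:R :> R by rewrite ler1n.
rewrite -[k.+2%:R]natr1 in hx a_le' *.
(* If [y + 1 <= x], replace [y + 1] by [x] in both growth bounds and add [A <= b + B]. *)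
have [xy|yx] := leP (y + 1) x.
  have := ler_wpM2r B0 xy; have := ler_wpM2r (ltW b0) xy.
  lra.
(* [A] is bounded by the convex combination of its two bounds that makes the
   coefficient of [B] equal to [(x + 1) / k.+2]. *)
pose c := (x - k.+1%:R) / (y + 1 - k.+1%:R).
have c0 : 0 <= c by rewrite divr_ge0 //; lra.
have c1 : c <= 1 by rewrite ler_pdivrMr; lra.
have cE : c * (y + 1 - k.+1%:R) = x - k.+1%:R by rewrite divfK //; lra.
(* Both sides contain [x * (x - k.+1) / k.+1]; what remains is [rbinom (x - 1) k <= rbinom y k],
   true because [x - 1 < y]. *)
have xa : (k.+1%:R + 1) * a <= x * c * b.
  have q_le : rbinom (x - 1) k <= rbinom y k.
    by apply: rbinom_mono; [rewrite -natr1 in hx; lra | lra].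
  have bcE : b * c = rbinom y k * ((x - k.+1%:R) / k.+1%:R).
    rewrite -bE rbinomSr -mulrA; congr (_ * _); rewrite mulrC -[in RHS]cE.
    by rewrite -[k.+1%:R]natr1; ring.
  rewrite -mulrA [c * b]mulrC bcE natr1 mulrC -ler_pdivlMr ?ltr0n //.
  apply: (le_trans a_le); rewrite rbinomSl mulrAC ler_pM2r ?invr_gt0 ?ltr0n //.
  rewrite ler_pM2l; last by lra.
  rewrite rbinomSr (_ : x - 1 - k%:R = x - k.+1%:R); last first.
    by rewrite -natr1; ring.
  by rewrite ler_wpM2r // divr_ge0 //; lra.
have := ler_wpM2l c0 A_le'.
have : 0 <= (k.+1%:R + 1 - k.+1%:R * c) * (b + B - A) by rewrite mulr_ge0 //; nra.
(* The total coefficient of [b] is [c * (x - k.+1) + k.+2], at most [x + 1] because [c <= 1]. *)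
have : 0 <= (1 - c) * (x - k.+1%:R) * b by rewrite !mulr_ge0 //; lra.
have : c * (y + 1 - k.+1%:R) * B = (x - k.+1%:R) * B by rewrite cE.
lra.
Qed.

End RealBinomial.

Lemma in_fset_sep (K : choiceType) (S : {fset K}) (P : pred K) (z : K) :
  (z \in [fset w in S | P w]) = (z \in S) && P z.
Proof. by rewrite in_fset inE. Qed.

(** * Monomials as exponent vectors, order ideals and multiplicities *)

Section Monomials.
Variable T : finType.
Notation mono := {ffun T -> nat}.
Implicit Types (u w : mono) (v : T) (k : nat) (M : pred mono).

Definition mdeg w : nat := (\sum_i w i)%N.
Definition mvar v : mono := [ffun i => (i == v) : nat].

(** Exponents in degree [k] are at most [k], so functions into ['I_k.+1] provide a finite set to
    filter. *)
Definition mons k : {fset mono} :=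
  [fset w in [fset [ffun i => val ((f : {ffun T -> 'I_k.+1}) i)] |
                f in {: {ffun T -> 'I_k.+1}}] | mdeg w == k].

Lemma leq_mdeg w v : (w v <= mdeg w)%N.
Proof. by rewrite /mdeg (bigD1 v) //= leq_addr. Qed.

Lemma mem_mons w k : (w \in mons k) = (mdeg w == k).
Proof.
rewrite in_fset_sep andb_idl // => /eqP dw.
have lt i : (w i < k.+1)%N by rewrite ltnS -dw leq_mdeg.
apply/imfsetP; exists [ffun i => Ordinal (lt i)] => //=.
by apply/ffunP => i; rewrite !ffunE.
Qed.

Lemma mdegD u w : mdeg (u + w) = (mdeg u + mdeg w)%N.
Proof. by rewrite /mdeg -big_split; apply: eq_bigr => i _; rewrite ffunE. Qed.

Lemma mdeg_var v : mdeg (mvar v) = 1%N.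
Proof.
rewrite /mdeg (bigD1 v) //= ffunE eqxx big1 // => i /negbTE iv.
by rewrite ffunE iv.
Qed.

Lemma mono_divvar w v : (0 < w v)%N -> exists u, w = u + mvar v.
Proof.
move=> wv; exists [ffun i => (w i - (i == v))%N]; apply/ffunP => i.
rewrite !ffunE; case: eqP => [->|_]; last by rewrite subn0 addr0.
by rewrite -[RHS]/(_ + _)%N subnK.
Qed.

Lemma mono_addIr u : injective (+%R^~ u : mono -> mono).
Proof.
move=> w w' /ffunP e; apply/ffunP => i.
by have := e i; rewrite !ffunE; apply: addIn.
Qed.

Lemma mulvarE w v : (w + mvar v) v = (w v).+1.
Proof. by rewrite !ffunE eqxx -[LHS]/(_ + _)%N addn1. Qed.

Lemma mdeg_gt0 w : (0 < mdeg w)%N -> exists v, (0 < w v)%N.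
Proof.
rewrite lt0n sum_nat_eq0 negb_forall => /existsP[v /=].
by exists v; rewrite lt0n.
Qed.

Definition level M k : {fset mono} := [fset w in mons k | M w].

Lemma mem_level M k w : (w \in level M k) = (mdeg w == k) && M w.
Proof. by rewrite in_fset_sep mem_mons. Qed.

(** Addition of exponent vectors is multiplication of monomials; removing one variable at a time
    reaches every divisor. *)
Definition order_ideal M := forall w v, M (w + mvar v) -> M w.

Definition colon M v : pred mono := fun w => M (w + mvar v).

Lemma order_ideal_colon M v : order_ideal M -> order_ideal (colon M v).
Proof. by move=> idM w u; rewrite /colon addrAC; apply: idM. Qed.

Lemma colon_level_sub M v k : order_ideal M -> level (colon M v) k `<=` level M k.
Proof.
move=> idM; apply/fsubsetP => w; rewrite !mem_level => /andP[-> /=].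
exact: idM.
Qed.

Lemma leq_sum_fsubset (S S' : {fset mono}) (F : mono -> nat) :
  S `<=` S' -> (\sum_(w <- S) F w <= \sum_(w <- S') F w)%N.
Proof.
move=> sub; rewrite [leqRHS](big_fsetID _ [in S]) /=.
rewrite (_ : [fset w in S' | w \in S] = S) ?leq_addr //.
by apply/fsetP => w; rewrite in_fset_sep andb_idl // => /(fsubsetP sub).
Qed.

Definition mult M v k : nat := (\sum_(w <- level M k) w v)%N.

(** Monomials without [v] contribute 0; the others are the [w + mvar v] with [w] in the colon ideal,
    and [w] is unique. *)
Lemma multS_sum M v k :
  mult M v k.+1 = (\sum_(w <- level (colon M v) k) (w v).+1)%N.
Proof.
rewrite /mult (big_fsetID _ [pred w : mono | (0 < w v)%N]) /=.
rewrite [X in (_ + X)%N]big1_fset ?addn0; last first.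
  by move=> w; rewrite in_fset_sep /= -eqn0Ngt => /andP[_ /eqP].
rewrite (_ : [fset w in level M k.+1 | (0 < w v)%N] =
  [fset w + mvar v | w in level (colon M v) k]).
  rewrite big_imfset /=; last by move=> u w _ _; apply: mono_addIr.
  by apply: eq_bigr => w _; rewrite mulvarE.
apply/fsetP => w; apply/idP/imfsetP => /= [|[u]].
  rewrite in_fset_sep => /andP[wM wv].
  have [u wE] := mono_divvar wv; exists u => //; move: wM.
  by rewrite wE !mem_level mdegD mdeg_var addn1 eqSS.
rewrite mem_level => /andP[du uM] ->; rewrite in_fset_sep.
by rewrite mem_level mdegD mdeg_var addn1 eqSS du [M _]uM mulvarE.
Qed.

Lemma multS M v k :
  mult M v k.+1 = (#|` level (colon M v) k| + mult (colon M v) v k)%N.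
Proof.
rewrite multS_sum; under eq_bigr => w _ do rewrite -add1n.
by rewrite big_split /= sum1_size.
Qed.

Lemma multS_le M v k : order_ideal M ->
  (mult M v k.+1 <= #|` level M k| + mult M v k)%N.
Proof.
move=> idM; rewrite multS_sum.
apply: (leq_trans (leq_sum_fsubset _ (colon_level_sub v k idM))).
under eq_bigr => w _ do rewrite -add1n.
by rewrite big_split /= sum1_size.
Qed.

(** Double counting: the exponents of a monomial of degree [k] add up to [k]. *)
Lemma sum_mult M k : (\sum_v mult M v k = k * #|` level M k|)%N.
Proof.
rewrite /mult exchange_big /= (eq_big_seq (fun _ => k)).
  by rewrite big_const_seq count_predT iter_addn_0.
by move=> w; rewrite mem_level => /andP[/eqP dw _].
Qed.

(** Handles an empty level of the colon ideal, to which no binomial parameter [y] can be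
    attached. *)
Lemma level0S M k : order_ideal M -> level M k = fset0 -> level M k.+1 = fset0.
Proof.
move=> idM lev0; apply/fsetP => w; rewrite in_fset0 mem_level.
apply/negP => /andP[/eqP dw wM].
have [v /mono_divvar[u wE]] : exists v, (0 < w v)%N by apply: mdeg_gt0; rewrite dw.
suff : u \in level M k by rewrite lev0.
by move: dw wM; rewrite wE mem_level mdegD mdeg_var addn1 => -[->] /idM ->; rewrite eqxx.
Qed.

(** * Growth of order ideals from one degree to the next *)

Section Growth.
Variable R : realType.
Implicit Types (x y : R).

Lemma level_growth_of_mult M k x :
    (forall v, k.+1%:R * (mult M v k.+2)%:R <= (x + 1) * (mult M v k.+1)%:R) ->
  k.+2%:R * #|` level M k.+2|%:R <= (x + 1) * #|` level M k.+1|%:R.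
Proof.
move=> mult_le; have k0 : 0 < k.+1%:R :> R by rewrite ltr0n.
rewrite -(ler_pM2l k0) -natrM -sum_mult natr_sum mulr_sumr.
rewrite mulrCA -natrM -sum_mult natr_sum mulr_sumr.
exact: ler_sum.
Qed.

(** Tracking a single variable makes the induction close. The hypothesis for [colon M v], with its
    own parameter [y], is used twice: for [v] itself, bounding the multiplicity, and summed over all
    variables, bounding the cardinal. *)
Lemma mult_growth M v k x : order_ideal M -> k.+1%:R <= x ->
    #|` level M k.+1|%:R = rbinom x k.+1 ->
  k.+1%:R * (mult M v k.+2)%:R <= (x + 1) * (mult M v k.+1)%:R.
Proof.
elim: k M v x => [|k IH] M v x idM hx cardM; 
  have idM' : order_ideal (colon M v) by exact: order_ideal_colon.
- rewrite mul1r (multS M v 1) (multS M v 0) !natrD.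
  have [/cardfs0_eq lev0|b0] := posnP #|` level (colon M v) 0|.
    by rewrite (level0S idM' lev0) /mult (level0S idM' lev0) lev0 !big_seq_fset0
       cardfs0 !addr0 mulr0.
  (* As [b >= 1], this gives [a <= x * b]; adding [A <= b + B] yields the base case. *)
  have a_le : #|` level (colon M v) 1|%:R <= x.
    rewrite (_ : x = rbinom x 1); last by rewrite rbinomSl rbinom0 divr1 mulr1.
    by rewrite -cardM ler_nat fsubset_leq_card // colon_level_sub.
  have A_le := @multS_le _ v 0 idM'; rewrite -(ler_nat R) natrD in A_le.
  have b1 : 1 <= #|` level (colon M v) 0|%:R :> R by rewrite ler1n.
  have B0 : 0 <= (mult (colon M v) v 0)%:R :> R by [].
  move: (_%:R) (_%:R) (_%:R) (_%:R) => a A b B in a_le A_le b1 B0 *.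
  nra.
- rewrite (multS M v k.+2) (multS M v k.+1) !natrD.
  have [/cardfs0_eq lev0|b0] := posnP #|` level (colon M v) k.+1|.
    by rewrite (level0S idM' lev0) /mult (level0S idM' lev0) lev0 !big_seq_fset0
       cardfs0 !addr0 !mulr0.
  have a_le : #|` level (colon M v) k.+2|%:R <= rbinom x k.+2.
    by rewrite -cardM ler_nat fsubset_leq_card // colon_level_sub.
  have A_le := @multS_le _ v k.+1 idM'; rewrite -(ler_nat R) natrD in A_le.
  have [y hy cardMv] := rbinom_surj R k b0.
  have A_le' := IH _ v y idM' hy (esym cardMv).
  have a_le' := level_growth_of_mult (fun v' => IH _ v' y idM' hy (esym cardMv)).
  have B0 : 0 <= (mult (colon M v) v k.+1)%:R :> R by [].
  exact: (growth_step_ineq hx hy cardMv B0 a_le A_le A_le' a_le').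
Qed.

Theorem level_growth M k x : order_ideal M -> k.+1%:R <= x ->
    #|` level M k.+1|%:R = rbinom x k.+1 ->
  #|` level M k.+2|%:R <= rbinom (x + 1) k.+2.
Proof.
move=> idM hx cardM; rewrite rbinomSl addrK -cardM mulrAC ler_pdivlMr ?ltr0n //.
rewrite mulrC; apply: level_growth_of_mult => v.
exact: mult_growth.
Qed.

End Growth.

End Monomials.

(** * Least-weight representations of the elements of a sumset *)

Section CanonicalMonomials.
Variables (G : zmodType) (A : {fset G}).
Notation mono := {ffun A -> nat}.
Implicit Types (u w : mono) (k : nat).

Definition eval w : G := \sum_i val i *+ w i.

Lemma evalD u w : eval (u + w) = eval u + eval w.
Proof.
rewrite /eval -big_split; apply: eq_bigr => i _ /=.
by rewrite ffunE -mulrnDr.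
Qed.

Lemma eval_var v : eval (mvar v) = val v.
Proof.
rewrite /eval (bigD1 v) //= ffunE eqxx mulr1n big1 ?addr0 // => i /negbTE iv.
by rewrite ffunE iv mulr0n.
Qed.

Lemma eval0 : eval 0 = 0.
Proof. by rewrite /eval big1 // => i _; rewrite ffunE mulr0n. Qed.

Lemma mdeg0 : mdeg (0 : mono) = 0%N.
Proof. by rewrite /mdeg big1 // => i _; rewrite ffunE. Qed.

Lemma hsumset_eval k (y : G) :
  y \in hsumset k A <-> exists2 w, mdeg w = k & eval w = y.
Proof.
split=> [/hsumsetP[a [aA ->]]|[w <- <-]].
  exists (\sum_(i < k) mvar [` aA i]).
    elim: k a aA => [|k IH] a aA; first by rewrite big_ord0 mdeg0.
    by rewrite big_ord_recr mdegD mdeg_var IH addn1.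
  elim: k a aA => [|k IH] a aA; first by rewrite !big_ord0 eval0.
  by rewrite !big_ord_recr evalD eval_var IH.
apply/hsumsetP; move dw: (mdeg w) => d.
elim: d w dw => [|d IH] w dw.
  exists (fun=> 0); split=> [[]//|]; rewrite big_ord0 /eval big1 // => i _.
  by have := leq_mdeg w i; rewrite dw leqn0 => /eqP->.
have [v /mono_divvar[u wE]] : exists v, (0 < w v)%N by apply: mdeg_gt0; rewrite dw.
move: dw; rewrite wE mdegD mdeg_var addn1 => -[/IH[a [aA uE]]].
exists (fun i => if unlift ord_max i is Some j then a j else val v); split.
  by move=> i; case: unliftP => [j|] _; [apply: aA | apply: valP].
rewrite big_ord_recr /= unlift_none evalD eval_var uE; congr (_ + _).
apply: eq_bigr => i _.
have -> : widen_ord (leqnSn d) i = lift ord_max i by apply/val_inj/esym/lift_max.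
by rewrite liftK.
Qed.

(* Any additive weight that separates monomials of bounded degree would do. *)
Variable N : nat.

Definition weight w : nat := (\sum_i w i * N ^ enum_rank i)%N.

Lemma weightD u w : weight (u + w) = (weight u + weight w)%N.
Proof.
rewrite /weight -big_split; apply: eq_bigr => i _ /=.
by rewrite ffunE -mulnDl.
Qed.

Lemma digits_inj n (f g : 'I_n -> nat) :
    (forall i, f i < N)%N -> (forall i, g i < N)%N ->
    (\sum_(i < n) f i * N ^ i = \sum_(i < n) g i * N ^ i)%N ->
  f =1 g.
Proof.
elim: n f g => [|n IH] f g fN gN; first by move=> _ [].
have N0 : (0 < N)%N by apply: leq_ltn_trans (fN ord0).
rewrite !big_ord_recl /= !expn0 !muln1.
have split (e : 'I_n.+1 -> nat) : (\sum_(i < n) e (lift ord0 i) * N ^ bump 0 i =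
    (\sum_(i < n) e (lift ord0 i) * N ^ i) * N)%N.
  rewrite big_distrl /=; apply: eq_bigr => i _.
  by rewrite /bump add1n expnS mulnA mulnAC.
rewrite !split => e.
have e0 : f ord0 = g ord0.
  by have := congr1 (modn^~ N) e; rewrite ![(_ + _ * N)%N]addnC !modnMDl !modn_small.
move=> i; case: (unliftP ord0 i) => [j|] -> //.
apply: (IH (fun j => f (lift ord0 j)) (fun j => g (lift ord0 j))) => //.
by move: e; rewrite e0 => /addnI/eqP; rewrite eqn_pmul2r // => /eqP.
Qed.

(** Exponents are at most the degree, hence are the base-[N] digits of the weight. *)
Lemma weight_inj u w :
  (mdeg u < N)%N -> (mdeg w < N)%N -> weight u = weight w -> u = w.
Proof.
move=> uN wN; rewrite /weight !(reindex _ (onW_bij _ (@enum_val_bij A))) /=.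
under eq_bigr => i _ do rewrite enum_valK.
under [in RHS]eq_bigr => i _ do rewrite enum_valK.
move/digits_inj => e; apply/ffunP => v; rewrite -[v]enum_rankK.
by apply: e => i; apply: leq_ltn_trans (leq_mdeg _ _) _.
Qed.

Definition canonical : pred mono := fun w =>
  all (fun u => (eval u == eval w) ==> (weight w <= weight u)%N) (mons A (mdeg w)).

Lemma canonicalP w : reflect
  (forall u, mdeg u = mdeg w -> eval u = eval w -> (weight w <= weight u)%N)
  (canonical w).
Proof.
apply: (iffP allP) => can u.
  by move=> du eu; apply: (implyP (can u _)); [rewrite mem_mons du | rewrite eu].
by rewrite mem_mons => /eqP du; apply/implyP => /eqP; apply: can.
Qed.

(** Degree, value and weight are additive, so a lighter rival [u] of [w] would give a lighter rival
    [u + mvar v] of [w + mvar v]. *)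
Lemma order_ideal_canonical : order_ideal canonical.
Proof.
move=> w v /canonicalP can; apply/canonicalP => u du eu.
have := can (u + mvar v).
by rewrite !mdegD !evalD du eu !weightD leq_add2r; apply.
Qed.

Lemma canonical_exists w :
  exists w', [/\ canonical w', mdeg w' = mdeg w & eval w' = eval w].
Proof.
pose P n := has (fun u => (eval u == eval w) && (weight u == n)) (mons A (mdeg w)).
have exP : exists n, P n.
  by exists (weight w); apply/hasP; exists w; rewrite ?mem_mons ?eqxx.
have [n /hasP[w']] := ex_minnP exP.
rewrite mem_mons => /eqP dw /andP[/eqP ew /eqP <-] min.
exists w'; split=> //; apply/canonicalP => u du eu; apply: min.
by apply/hasP; exists u; rewrite ?mem_mons ?du ?dw ?eu ?ew ?eqxx.
Qed.

(** [eval] is a bijection from the canonical monomials onto the sumset: two canonical monomials with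
    the same value have equal weights, and [k < N] lets the weight separate them. *)
Lemma card_level_canonical k : (k < N)%N ->
  #|` level canonical k| = #|` hsumset k A|.
Proof.
move=> kN; rewrite (_ : hsumset k A = [fset eval w | w in level canonical k]).
  rewrite [RHS]card_in_imfset //= => u w; rewrite !mem_level.
  move=> /andP[/eqP du /canonicalP cu] /andP[/eqP dw /canonicalP cw] e.
  apply: weight_inj; rewrite ?du ?dw //; apply/eqP; rewrite eqn_leq.
  by rewrite cu ?cw ?du ?dw.
apply/fsetP => y; apply/idP/imfsetP => /= [/hsumset_eval[w dw <-]|[w]].
  have [w' [cw' dw' ew']] := canonical_exists w.
  by exists w'; rewrite // mem_level dw' dw eqxx.
by rewrite mem_level => /andP[/eqP dw _] ->; apply/hsumset_eval; exists w.
Qed.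

End CanonicalMonomials.

(** * Transfer to sumsets and the two bounds *)

Lemma hsumset_growth (R : realType) (G : zmodType) (A : {fset G}) k (x : R) :
    k.+1%:R <= x -> #|` hsumset k.+1 A|%:R = rbinom x k.+1 ->
  #|` hsumset k.+2 A|%:R <= rbinom (x + 1) k.+2.
Proof.
(* The base [k.+3] exceeds both degrees [k.+1] and [k.+2], so one order ideal serves both. *)
rewrite -!(@card_level_canonical _ _ k.+3) //.
exact/level_growth/order_ideal_canonical.
Qed.

Lemma hsumset_neq0 (G : zmodType) (A : {fset G}) k :
  A != fset0 -> (0 < #|` hsumset k A|)%N.
Proof.
case/fset0Pn => a aA; rewrite cardfs_gt0; apply/fset0Pn.
exists (\sum_(i < k) a); apply/hsumsetP; by exists (fun=> a).
Qed.

Theorem theorem4p4 (R : realType) (G : zmodType) (A : {fset G}) (h : nat) (x : R)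
    (A_neq0 : A != fset0) (h_ge2 : (2 <= h)%N)
    (x_geh : h%:R <= x) (card_hA : #|` hsumset h A|%:R = rbinom x h) :
  rbinom (x - 1) (h - 1) <= #|` hsumset (h - 1) A|%:R /\
  #|` hsumset (h + 1) A|%:R <= rbinom (x + 1) (h + 1).
Proof.
case: h h_ge2 x_geh card_hA => [|[|k]] // _ hx cardA.
rewrite addn1 subn1 /=; split; last exact: hsumset_growth.
(* With [y] the parameter of the smaller sumset, it suffices that [x - 1 <= y]. If [y + 1 < x],
   strict monotonicity would contradict the growth bound [rbinom x k.+2 <= rbinom (y + 1) k.+2]. *)
have [y hy cardA'] := rbinom_surj R k (hsumset_neq0 k.+1 A_neq0).
rewrite -cardA'; apply: rbinom_mono; first by rewrite -natr1 in hx; lra.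
have := hsumset_growth hy (esym cardA'); rewrite cardA.
have [xy|yx] := leP x (y + 1); first by move=> _; lra.
by rewrite leNgt rbinom_smono // -natr1; lra.
Qed.
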